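(* Let $k\to A$ be a unital homomorphism of commutative unital rings and let $f\in Z^2(\mathrm{Der}_k(A),A)$ be a 2-cocycle. The constructions $\tilde L\mapsto U^{\otimes}(\tilde L)$ and $\tilde L\mapsto U^{\rho}(\tilde L)$ define covariant functors from the category of $D^1_f(A)$-Lie algebras to the category of associative unital rings, with the following property: for every $D^1_f(A)$-Lie algebra $\tilde L$ there are exact equivalences of categories $$F_1:\mathrm{Mod}(\tilde L,Id)\cong \mathrm{Mod}(U^{\otimes}(\tilde L)),\qquad F_2:\mathrm{Conn}(\tilde L,Id)\cong \mathrm{Mod}(U^{\rho}(\tilde L)),$$ and $F_1$ and $F_2$ preserve injective and projective objects.
   Context: An $A\otimes_kA$-module $M$ is regarded as having commuting left and right actions $am=(a\otimes 1)m$, $ma=(1\otimes a)m$. A 2-cocycle $f\in Z^2(\mathrm{Der}_k(A),A)$ is an alternating $A$-bilinear map $f:\mathrm{Der}_k(A)\times\mathrm{Der}_k(A)\to A$ with $x(f(y,z))-y(f(x,z))+z(f(x,y))-f([x,y],z)+f([x,z],y)-f([y,z],x)=0$. $D^1_f(A)=A\oplus\mathrm{Der}_k(A)$, with elements written $aI+x$, has actions $c(aI+x)=(ca)I+cx$, $(aI+x)c=(ac+x(c))I+cx$, bracket $[aI+x,bI+y]=(x(b)-y(a)+f(x,y))I+[x,y]$, and projection $\pi(aI+x)=x$. $\mathrm{Der}_k(A)$ carries the trivial right $A$-module structure (right action equal to left action). A $D^1_f(A)$-Lie algebra (a $\mathrm D$-Lie algebra) is a 5-tuple $(\tilde L,\tilde\alpha,\tilde\pi,[,],D)$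 where $\tilde L$ is an $A\otimes_kA$-module and a $k$-Lie algebra, $\tilde\alpha:\tilde L\to D^1_f(A)$ and $\tilde\pi:\tilde L\to\mathrm{Der}_k(A)$ are maps of $A\otimes_kA$-modules and $k$-Lie algebras with $\pi\circ\tilde\alpha=\tilde\pi$, $D\in\tilde L$ is central for the Lie bracket, $\tilde\pi(D)=0$, and for all $u,v\in\tilde L$, $c\in A$: $uc=cu+\tilde\pi(u)(c)D$ and $[u,cv]=c[u,v]+\tilde\pi(u)(c)v$. A morphism $(\tilde L,\tilde\alpha,\tilde\pi,[,],D)\to(\tilde M,\tilde\beta,\tilde\gamma,[,],D')$ is a map $\phi$ of $k$-Lie algebras and $A\otimes_kA$-modules with $\tilde\beta\circ\phi=\tilde\alpha$ and $\phi(D)=D'$. For a left $A$-module $E$, $\mathrm{End}_k(E)$ is the $A\otimes_kA$-module with $(a\psi)(e)=a\psi(e)$, $(\psi a)(e)=\psi(ae)$. $\mathrm{Mod}(\tilde L,Id)$ has objects $(E,\rho)$ with $E$ a left $A$-module and $\rho:\tilde L\to\mathrm{End}_k(E)$ an $A\otimes_kA$-linear map with $\rho(D)=Id_E$. $\mathrm{Conn}(\tilde L,Id)$ has objects $(E,\rho)$ with $E$ a left $A$-module and $\rho:\tilde L\to\mathrm{End}_k(E)$ a left $A$-linear map with $\rho(D)=Id_E$ and $\rho(x)(ae)=a\rho(x)(e)+\tilde\pi(x)(a)e$ for all $x\in\tilde L,a\in A,e\in E$. In both categories morphisms are $A$-linear maps $\phi$ with $\phi\circ\rho(u)=\rho'(u)\circ\phi$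 for all $u\in\tilde L$. Let $T^*_k(\tilde L)$ be the tensor algebra of $\tilde L$ over $k$. $U^{\otimes}(\tilde L)=T^*_k(\tilde L)/J_1$, where $J_1$ is the 2-sided ideal generated by $D-1$, $au-(aD)\otimes u$, $vb-v\otimes(bD)$; $U^{\rho}(\tilde L)=T^*_k(\tilde L)/J_2$, where $J_2$ is the 2-sided ideal generated by $D-1$, $au-(aD)\otimes u$, $v\otimes(bD)-(bD)\otimes v-\tilde\pi(v)(b)D$ (for all $a,b\in A$, $u,v\in\tilde L$). On a morphism $\phi$, both functors are induced by $u_1\otimes\cdots\otimes u_i\mapsto\phi(u_1)\otimes\cdots\otimes\phi(u_i)$. $\mathrm{Mod}(R)$ is the category of left $R$-modules. *)

(* Defs.v *)
From HB Require Import structures.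
From mathcomp Require Import all_boot all_algebra ring.
From mathcomp Require Import boolp.

Set Implicit Arguments.
Unset Strict Implicit.
Unset Printing Implicit Defensive.

Import GRing.Theory.
Local Open Scope ring_scope.
Local Open Scope quotient_scope.

Record category := Category {
  obj :> Type;
  hom : obj -> obj -> Type;
  idm : forall X, hom X X;
  comp : forall X Y Z, hom Y Z -> hom X Y -> hom X Z;
  compA : forall X Y Z T (h : hom Z T) (g : hom Y Z) (f : hom X Y),
    comp h (comp g f) = comp (comp h g) f;
  comp1m : forall X Y (f : hom X Y), comp (idm Y) f = f;
  compm1 : forall X Y (f : hom X Y), comp f (idm X) = f }.

Arguments idm {c} X.
Arguments comp {c X Y Z} g f.

(* [functor_on F0] is a functorial structure on a given map of objects. *)
Record functor_on (C D : category) (F0 : C -> D) := FunctorOn {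
  fmap : forall X Y : C, hom X Y -> hom (F0 X) (F0 Y);
  fmap_id : forall X : C, fmap (idm X) = idm (F0 X);
  fmap_comp : forall (X Y Z : C) (g : hom Y Z) (f : hom X Y),
    fmap (comp g f) = comp (fmap g) (fmap f) }.

Arguments fmap {C D F0} f0 {X Y} f.

Record functor (C D : category) := Functor {
  fobj :> C -> D;
  farr :> functor_on fobj }.

Definition id_functor (C : category) : functor C C.
Proof. by exists id; exists (fun X Y f => f). Defined.

Definition comp_functor (C D E : category) (G : functor D E) (F : functor C D) :
  functor C E.
Proof.
exists (fun X => G (F X)); exists (fun X Y f => fmap G (fmap F f)).
  by move=> X; rewrite !fmap_id.
by move=> X Y Z g f; rewrite !fmap_comp.
Defined.

Definition is_iso (C : category) (X Y : C) (f : hom X Y) :=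
  exists g : hom Y X, comp g f = idm X /\ comp f g = idm Y.

Definition naturally_isomorphic (C D : category) (F G : functor C D) :=
  exists t : forall X : C, hom (F X) (G X),
    (forall X, is_iso (t X)) /\
    (forall (X Y : C) (f : hom X Y), comp (t Y) (fmap F f) = comp (fmap G f) (t X)).

Definition is_equivalence (C D : category) (F : functor C D) :=
  exists G : functor D C,
    naturally_isomorphic (comp_functor G F) (id_functor C) /\
    naturally_isomorphic (comp_functor F G) (id_functor D).

Definition monomorphism (C : category) (X Y : C) (i : hom X Y) :=
  forall (Z : C) (g h : hom Z X), comp i g = comp i h -> g = h.

Definition epimorphism (C : category) (X Y : C) (p : hom X Y) :=
  forall (Z : C) (g h : hom Y Z), comp g p = comp h p -> g = h.

Definition injective_object (C : category) (I : C) :=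
  forall (X Y : C) (i : hom X Y) (f : hom X I), monomorphism i ->
    exists g : hom Y I, comp g i = f.

Definition projective_object (C : category) (P : C) :=
  forall (X Y : C) (p : hom X Y) (f : hom P Y), epimorphism p ->
    exists g : hom P X, comp p g = f.

Definition preserves_injectives (C D : category) (F : functor C D) :=
  forall X : C, injective_object X -> injective_object (F X).

Definition preserves_projectives (C D : category) (F : functor C D) :=
  forall X : C, projective_object X -> projective_object (F X).

Lemma additive_ext (U V : zmodType) (f g : {additive U -> V}) : f =1 g -> f = g.
Proof.
case: f g => [f [[fP]]] [g [[gP]]] /= /funext eqfg; subst g.
by rewrite (Prop_irrelevance fP gP).
Qed.

Lemma linear_ext (R : pzRingType) (U V : lmodType R) (f g : {linear U -> V}) :
  f =1 g -> f = g.
Proof.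
case: f g => [f [[f1] [f2]]] [g [[g1] [g2]]] /= /funext eqfg; subst g.
by rewrite (Prop_irrelevance f1 g1) (Prop_irrelevance f2 g2).
Qed.

Lemma rmorphism_ext (R S : pzRingType) (f g : {rmorphism R -> S}) :
  f =1 g -> f = g.
Proof.
case: f g => [f [[f1] [f2]]] [g [[g1] [g2]]] /= /funext eqfg; subst g.
by rewrite (Prop_irrelevance f1 g1) (Prop_irrelevance f2 g2).
Qed.

Definition Ab : category.
Proof.
exists zmodType (fun U V : zmodType => {additive U -> V}) (fun U => idfun)
  (fun U V W (g : {additive V -> W}) (f : {additive U -> V}) => g \o f).
- by move=> *; apply: additive_ext.
- by move=> *; apply: additive_ext.
- by move=> *; apply: additive_ext.
Defined.

Definition RingCat : category.
Proof.
exists pzRingType (fun R S : pzRingType => {rmorphism R -> S}) (fun R => idfun)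
  (fun R S T (g : {rmorphism S -> T}) (f : {rmorphism R -> S}) => g \o f).
- by move=> *; apply: rmorphism_ext.
- by move=> *; apply: rmorphism_ext.
- by move=> *; apply: rmorphism_ext.
Defined.

Definition LMod (R : pzRingType) : category.
Proof.
exists (lmodType R) (fun M N : lmodType R => {linear M -> N}) (fun M => idfun)
  (fun (M N P : lmodType R) (g : {linear N -> P}) (f : {linear M -> N}) => g \o f).
- by move=> *; apply: linear_ext.
- by move=> *; apply: linear_ext.
- by move=> *; apply: linear_ext.
Defined.

Definition LMod_forget (R : pzRingType) : functor (LMod R) Ab.
Proof.
exists (fun M : lmodType R => M : zmodType).
exists (fun (M N : lmodType R) (f : {linear M -> N}) => f : {additive M -> N}).
- by move=> M; apply: additive_ext.
- by move=> *; apply: additive_ext.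
Defined.

Definition exact_at (U V W : zmodType) (g : U -> V) (h : V -> W) :=
  forall y, h y = 0 <-> exists x, g x = y.

(* Exactness and additivity in a category of modules with extra structure are
   those of the underlying abelian groups, given by the functors [UC], [UD]. *)
Definition exact_functor (C D : category) (UC : functor C Ab) (UD : functor D Ab)
    (F : functor C D) :=
  (forall (X Y : C) (u v w : hom X Y),
     (forall x, (fmap UC w : {additive _ -> _}) x =
        (fmap UC u : {additive _ -> _}) x + (fmap UC v : {additive _ -> _}) x) ->
     (forall x, (fmap UD (fmap F w) : {additive _ -> _}) x =
        (fmap UD (fmap F u) : {additive _ -> _}) x +
        (fmap UD (fmap F v) : {additive _ -> _}) x)) /\
  (forall (X Y Z : C) (u : hom X Y) (v : hom Y Z),
     exact_at (fmap UC u : {additive _ -> _}) (fmap UC v : {additive _ -> _}) ->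
     exact_at (fmap UD (fmap F u) : {additive _ -> _})
              (fmap UD (fmap F v) : {additive _ -> _})).

Section RingQuotient.
Variable R : pzRingType.

Definition two_sided_ideal (I : R -> Prop) :=
  [/\ I 0, forall x y, I x -> I y -> I (x - y) &
      forall a x, I x -> I (a * x) /\ I (x * a)].

Definition ideal_gen (S : R -> Prop) (x : R) :=
  forall I, two_sided_ideal I -> (forall s, S s -> I s) -> I x.

Lemma ideal_genP S : two_sided_ideal (ideal_gen S).
Proof.
split=> [I [] //|x y Ix Iy I II SI|a x Ix].
  by case: (II) => _ + _; apply; [apply: Ix|apply: Iy].
by split=> I II SI; case: (II) => _ _ /(_ a x (Ix I II SI)) [].
Qed.

Definition ideal_pred S : pred R := fun x => `[< ideal_gen S x >].

Lemma ideal_pred_zmod S : zmod_closed (ideal_pred S).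
Proof.
have [I0 IB _] := ideal_genP S.
split; first exact/asboolP.
move=> x y /asboolP Ix /asboolP Iy; apply/asboolP; exact: IB Ix Iy.
Qed.

Definition ideal_closed S : zmodClosed R :=
  HB.pack (ideal_pred S)
    (GRing.isZmodClosed.Build R (ideal_pred S) (ideal_pred_zmod S)).

Definition quot_ring (S : R -> Prop) : Type := @Quotient.quot R (ideal_closed S).
HB.instance Definition _ S := GRing.Zmodule.on (quot_ring S).
HB.instance Definition _ S : EqQuotient R (@Quotient.equiv R (ideal_closed S)) (quot_ring S) :=
  EqQuotient.on (quot_ring S).

Variable S : R -> Prop.
Local Notation Q := (quot_ring S).

Definition quot_cls (x : R) : Q := \pi x.

Lemma quot_clsP x y : quot_cls x = quot_cls y <-> ideal_gen S (x - y).
Proof.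
split=> [/eqP|xy]; last by apply/eqP; rewrite piE Quotient.equivE; apply/asboolP.
by rewrite piE Quotient.equivE => /asboolP.
Qed.

Lemma quot_clsD x y : quot_cls (x + y) = quot_cls x + quot_cls y.
Proof. by rewrite /quot_cls !piE. Qed.

Definition quot_mul (x y : Q) : Q := quot_cls (repr x * repr y).

Lemma quot_clsM x y : quot_cls (x * y) = quot_mul (quot_cls x) (quot_cls y).
Proof.
apply/quot_clsP; have [I0 IB IM] := ideal_genP S.
set x' := repr _; set y' := repr _.
have Ix : ideal_gen S (x - x') by apply/quot_clsP; rewrite /quot_cls reprK.
have Iy : ideal_gen S (y' - y) by apply/quot_clsP; rewrite /quot_cls reprK.
have -> : x * y - x' * y' = (x - x') * y - x' * (y' - y).
  by rewrite mulrBl mulrBr opprB addrA subrK.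
by apply: IB; [case: (IM y _ Ix)|case: (IM x' _ Iy)].
Qed.

Lemma quot_ind (P : Q -> Prop) : (forall x, P (quot_cls x)) -> forall q, P q.
Proof. by move=> PQ q; rewrite -[q]reprK; apply: PQ. Qed.

Fact quot_mulA : associative quot_mul.
Proof. by do 3![elim/quot_ind=> ?]; rewrite -!quot_clsM mulrA. Qed.
Fact quot_mul1r : left_id (quot_cls 1) quot_mul.
Proof. by elim/quot_ind=> x; rewrite -!quot_clsM mul1r. Qed.
Fact quot_mulr1 : right_id (quot_cls 1) quot_mul.
Proof. by elim/quot_ind=> x; rewrite -!quot_clsM mulr1. Qed.
Fact quot_mulDl : left_distributive quot_mul +%R.
Proof.
by do 3![elim/quot_ind=> ?]; rewrite -quot_clsD -!quot_clsM mulrDl quot_clsD.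
Qed.
Fact quot_mulDr : right_distributive quot_mul +%R.
Proof.
by do 3![elim/quot_ind=> ?]; rewrite -quot_clsD -!quot_clsM mulrDr quot_clsD.
Qed.

HB.instance Definition _ := GRing.Zmodule_isPzRing.Build Q
  quot_mulA quot_mul1r quot_mulr1 quot_mulDl quot_mulDr.

Fact quot_cls_additive : zmod_morphism quot_cls.
Proof.
move=> x y; apply: (addIr (quot_cls y)).
by rewrite -quot_clsD !subrK.
Qed.
HB.instance Definition _ := GRing.isZmodMorphism.Build R Q quot_cls quot_cls_additive.
Fact quot_cls_monoid : monoid_morphism quot_cls.
Proof. by split=> // x y; rewrite quot_clsM. Qed.
HB.instance Definition _ := GRing.isMonoidMorphism.Build R Q quot_cls quot_cls_monoid.

End RingQuotient.

Section TensorAlgebra.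
Variables (k : comPzRingType) (V : lmodType k).

(* The formal sum [:: (t1, w1); ...; (tn, wn)] stands for t1 w1 + ... + tn wn,
   where the word w = [:: v1; ...; vi] stands for the pure tensor v1 ⊗ ... ⊗ vi
   (for i = 0, the unit). The relations below are homogeneous in the length of
   words and cut out, in length i, the i-th tensor power of V over k. *)
Definition tsum : Type := seq (k * seq V).

Inductive teq : tsum -> tsum -> Prop :=
| teq_refl s : teq s s
| teq_sym s1 s2 : teq s1 s2 -> teq s2 s1
| teq_trans s1 s2 s3 : teq s1 s2 -> teq s2 s3 -> teq s1 s3
| teq_cat s1 s1' s2 s2' : teq s1 s1' -> teq s2 s2' -> teq (s1 ++ s2) (s1' ++ s2')
| teq_catC s1 s2 : teq (s1 ++ s2) (s2 ++ s1)
| teq_coef0 w : teq [:: (0, w)] [::]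
| teq_coefD a b w : teq [:: (a + b, w)] [:: (a, w); (b, w)]
| teq_tensD a w1 u v w2 :
    teq [:: (a, w1 ++ (u + v) :: w2)] [:: (a, w1 ++ u :: w2); (a, w1 ++ v :: w2)]
| teq_tensZ a b w1 u w2 :
    teq [:: (a, w1 ++ (b *: u) :: w2)] [:: (a * b, w1 ++ u :: w2)].

Definition teqb (s1 s2 : tsum) : bool := `[< teq s1 s2 >].

Fact teqb_equiv : equiv_class_of teqb.
Proof.
split=> [s|s1 s2|s2 s1 s3]; first by apply/asboolP; constructor.
  by apply/asboolP/asboolP; apply: teq_sym.
by move=> /asboolP h1 /asboolP h2; apply/asboolP; apply: teq_trans h1 h2.
Qed.

Canonical teqb_equivRel := EquivRelPack teqb_equiv.
Canonical teqb_encModRel := defaultEncModRel teqb.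

Definition tensalg : Type := {eq_quot teqb}.
HB.instance Definition _ : EqQuotient tsum teqb tensalg := EqQuotient.on tensalg.
HB.instance Definition _ := Choice.on tensalg.

Definition tcls (s : tsum) : tensalg := \pi s.

(* [tpure [:: v1; ...; vi]] is v1 ⊗ ... ⊗ vi *)
Definition tpure (w : seq V) : tensalg := tcls [:: (1, w)].

Lemma tclsP s1 s2 : tcls s1 = tcls s2 <-> teq s1 s2.
Proof.
split=> [/eqP|h]; first by rewrite piE => /asboolP.
by apply/eqP; rewrite piE; apply/asboolP.
Qed.

Lemma teq_repr s : teq (repr (tcls s)) s.
Proof. by apply/tclsP; rewrite /tcls reprK. Qed.

Lemma tens_ind (P : tensalg -> Prop) : (forall s, P (tcls s)) -> forall q, P q.
Proof. by move=> PQ q; rewrite -[q]reprK; apply: PQ. Qed.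

Definition tsum_opp (s : tsum) : tsum := [seq (- x.1, x.2) | x <- s].
Definition tsum_mul (s1 s2 : tsum) : tsum :=
  [seq (x.1 * y.1, x.2 ++ y.2) | x <- s1, y <- s2].

Lemma teq_cons x s s' : teq s s' -> teq (x :: s) (x :: s').
Proof. by move=> h; apply: (@teq_cat [:: x] [:: x]) => //; constructor. Qed.

Lemma teq_ACA s1 s2 s3 s4 : teq ((s1 ++ s2) ++ (s3 ++ s4)) ((s1 ++ s3) ++ (s2 ++ s4)).
Proof.
rewrite -!catA; apply: teq_cat; first by constructor.
by rewrite !catA; apply: teq_cat; [apply: teq_catC|constructor].
Qed.

Lemma teq_cat_opp s : teq (tsum_opp s ++ s) [::].
Proof.
elim: s => [|x s ih] /=; first by constructor.
apply: (@teq_trans _ ([:: (- x.1, x.2); x] ++ (tsum_opp s ++ s))).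
  exact: (teq_ACA [:: (- x.1, x.2)] (tsum_opp s) [:: x] s).
rewrite -(cats0 [::]); apply: teq_cat => //.
case: x => a w /=; apply: (@teq_trans _ [:: (- a + a, w)]).
  by apply/teq_sym/teq_coefD.
by rewrite addNr; apply: teq_coef0.
Qed.

Lemma teq_opp s s' : teq s s' -> teq (tsum_opp s) (tsum_opp s').
Proof.
move=> h; apply: (@teq_trans _ (tsum_opp s ++ (tsum_opp s' ++ s'))).
  rewrite -{1}(cats0 (tsum_opp s)); apply: teq_cat; first by constructor.
  exact/teq_sym/teq_cat_opp.
apply: (@teq_trans _ ((tsum_opp s ++ s) ++ tsum_opp s')).
  rewrite -catA; apply: teq_cat; first by constructor.
  apply: (teq_trans (teq_catC _ _)).
  by apply: teq_cat; [apply: teq_sym|constructor].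
rewrite -{2}(cat0s (tsum_opp s')); apply: teq_cat; last by constructor.
exact: teq_cat_opp.
Qed.

Lemma tsum_mulDl s1 s2 s : tsum_mul (s1 ++ s2) s = tsum_mul s1 s ++ tsum_mul s2 s.
Proof. by rewrite /tsum_mul allpairs_cat. Qed.

Lemma tsum_mul_cons x s1 s2 :
  tsum_mul (x :: s1) s2 = tsum_mul [:: x] s2 ++ tsum_mul s1 s2.
Proof. by rewrite -cat1s tsum_mulDl. Qed.

Lemma tsum_mul1E x s : tsum_mul [:: x] s = [seq (x.1 * y.1, x.2 ++ y.2) | y <- s].
Proof. by rewrite /tsum_mul /= cats0. Qed.

Lemma teq_mulDr s s1 s2 :
  teq (tsum_mul s (s1 ++ s2)) (tsum_mul s s1 ++ tsum_mul s s2).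
Proof.
elim: s => [|x s ih]; first by constructor.
rewrite tsum_mul_cons [tsum_mul (x :: s) s1]tsum_mul_cons.
rewrite [tsum_mul (x :: s) s2]tsum_mul_cons.
apply: teq_trans (teq_ACA _ _ _ _).
by apply: teq_cat => //; rewrite !tsum_mul1E map_cat; constructor.
Qed.

Lemma teq_mul1 x s s' : teq s s' -> teq (tsum_mul [:: x] s) (tsum_mul [:: x] s').
Proof.
case: x => c w0; rewrite !tsum_mul1E.
elim=> {s s'} [s|s1 s2 _|s1 s2 s3 _ h1 _ h2|s1 s1' s2 s2' _ h1 _ h2|s1 s2|w|a b w
  |a w1 u v w2|a b w1 u w2] /=.
- by constructor.
- exact: teq_sym.
- exact: teq_trans h1 h2.
- by rewrite !map_cat; apply: teq_cat.
- by rewrite !map_cat; apply: teq_catC.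
- by rewrite mulr0; apply: teq_coef0.
- by rewrite mulrDr; apply: teq_coefD.
- by rewrite !catA; apply: teq_tensD.
- by rewrite !catA mulrA; apply: teq_tensZ.
Qed.

Lemma teq_mulr s s1 s2 : teq s1 s2 -> teq (tsum_mul s s1) (tsum_mul s s2).
Proof.
move=> h; elim: s => [|x s ih]; first by constructor.
rewrite tsum_mul_cons [tsum_mul (x :: s) s2]tsum_mul_cons.
by apply: teq_cat => //; apply: teq_mul1.
Qed.

Lemma teq_1mul x s s' : teq s s' -> teq (tsum_mul s [:: x]) (tsum_mul s' [:: x]).
Proof.
have E r : tsum_mul r [:: x] = [seq (y.1 * x.1, y.2 ++ x.2) | y <- r].
  by elim: r => //= y r ih; rewrite tsum_mul_cons ih.
case: x E => c w0 E; rewrite !E /=.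
elim=> {s s'} [s|s1 s2 _|s1 s2 s3 _ h1 _ h2|s1 s1' s2 s2' _ h1 _ h2|s1 s2|w|a b w
  |a w1 u v w2|a b w1 u w2] /=.
- by constructor.
- exact: teq_sym.
- exact: teq_trans h1 h2.
- by rewrite !map_cat; apply: teq_cat.
- by rewrite !map_cat; apply: teq_catC.
- by rewrite mul0r; apply: teq_coef0.
- by rewrite mulrDl; apply: teq_coefD.
- by rewrite -!catA; apply: teq_tensD.
- by rewrite -!catA mulrAC; apply: teq_tensZ.
Qed.

Lemma tsum_muls0 s : tsum_mul s [::] = [::].
Proof. by elim: s => //= x s ih; rewrite tsum_mul_cons ih. Qed.

Lemma teq_mull s s1 s2 : teq s1 s2 -> teq (tsum_mul s1 s) (tsum_mul s2 s).
Proof.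
move=> h; elim: s => [|x s ih]; first by rewrite !tsum_muls0; constructor.
rewrite -cat1s; apply: teq_trans (teq_mulDr _ _ _) _.
apply: teq_trans (teq_sym (teq_mulDr _ _ _)).
by apply: teq_cat => //; apply: teq_1mul.
Qed.

Lemma tsum_mul1A x s2 s3 :
  tsum_mul [:: x] (tsum_mul s2 s3) = tsum_mul (tsum_mul [:: x] s2) s3.
Proof.
elim: s2 => [|y s2 ih]; first by [].
rewrite (tsum_mul_cons y) tsum_mul1E map_cat -!tsum_mul1E ih.
rewrite [tsum_mul [:: x] (y :: s2)]tsum_mul1E /= -tsum_mul1E.
rewrite [in RHS]tsum_mul_cons; congr (_ ++ _).
by rewrite !tsum_mul1E -map_comp; apply: eq_map => z /=; rewrite mulrA catA.
Qed.

Lemma tsum_mulA s1 s2 s3 : tsum_mul s1 (tsum_mul s2 s3) = tsum_mul (tsum_mul s1 s2) s3.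
Proof.
elim: s1 => //= x s1 ih; rewrite (tsum_mul_cons x s1 (tsum_mul s2 s3)) ih.
by rewrite (tsum_mul_cons x s1 s2) tsum_mulDl tsum_mul1A.
Qed.

Definition tzero := tcls [::].
Definition tone := tpure [::].
Definition tadd (x y : tensalg) := tcls (repr x ++ repr y).
Definition topp (x : tensalg) := tcls (tsum_opp (repr x)).
Definition tmul (x y : tensalg) := tcls (tsum_mul (repr x) (repr y)).

Lemma taddE s1 s2 : tadd (tcls s1) (tcls s2) = tcls (s1 ++ s2).
Proof. by apply/tclsP/teq_cat; apply: teq_repr. Qed.
Lemma toppE s : topp (tcls s) = tcls (tsum_opp s).
Proof. by apply/tclsP/teq_opp; apply: teq_repr. Qed.
Lemma tmulE s1 s2 : tmul (tcls s1) (tcls s2) = tcls (tsum_mul s1 s2).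
Proof.
apply/tclsP; apply: (teq_trans (teq_mull _ (teq_repr _))).
exact: teq_mulr (teq_repr _).
Qed.

Fact taddA : associative tadd.
Proof. by do 3![elim/tens_ind=> ?]; rewrite !taddE catA. Qed.
Fact taddC : commutative tadd.
Proof. by do 2![elim/tens_ind=> ?]; rewrite !taddE; apply/tclsP/teq_catC. Qed.
Fact tadd0 : left_id tzero tadd.
Proof. by elim/tens_ind=> s; rewrite taddE. Qed.
Fact taddN : left_inverse tzero topp tadd.
Proof. by elim/tens_ind=> s; rewrite toppE taddE; apply/tclsP/teq_cat_opp. Qed.

HB.instance Definition _ := GRing.isZmodule.Build tensalg taddA taddC tadd0 taddN.

Fact tmulA : associative tmul.
Proof. by do 3![elim/tens_ind=> ?]; rewrite !tmulE tsum_mulA. Qed.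
Fact tmul1r : left_id tone tmul.
Proof.
elim/tens_ind=> s; rewrite tmulE tsum_mul1E /=; congr tcls.
by rewrite -[RHS]map_id; apply: eq_map => -[a w] /=; rewrite mul1r.
Qed.
Fact tmulr1 : right_id tone tmul.
Proof.
elim/tens_ind=> s; rewrite tmulE; congr tcls.
elim: s => //= -[a w] s ih; rewrite tsum_mul_cons ih.
by rewrite tsum_mul1E /= mulr1 cats0.
Qed.
Fact tmulDl : left_distributive tmul tadd.
Proof. by do 3![elim/tens_ind=> ?]; rewrite !(taddE, tmulE) tsum_mulDl. Qed.
Fact tmulDr : right_distributive tmul tadd.
Proof.
by do 3![elim/tens_ind=> ?]; rewrite !(taddE, tmulE); apply/tclsP/teq_mulDr.
Qed.

HB.instance Definition _ := GRing.Zmodule_isPzRing.Build tensalg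
  tmulA tmul1r tmulr1 tmulDl tmulDr.

Definition tscal (a : k) : tensalg := tcls [:: (a, [::])].
Definition tgen (v : V) : tensalg := tpure [:: v].

Lemma tclsD s1 s2 : tcls (s1 ++ s2) = tcls s1 + tcls s2.
Proof. by rewrite -taddE. Qed.

Lemma tclsM s1 s2 : tcls (tsum_mul s1 s2) = tcls s1 * tcls s2.
Proof. by rewrite -tmulE. Qed.

Lemma tclsE s : tcls s = \sum_(x <- s) tscal x.1 * \prod_(v <- x.2) tgen v.
Proof.
elim: s => [|[a w] s ih]; first by rewrite big_nil.
rewrite big_cons -cat1s tclsD ih; congr (_ + _) => /=.
have -> : \prod_(v <- w) tgen v = tpure w.
  elim: w => [|v w ihw]; first by rewrite big_nil.
  by rewrite big_cons ihw -tclsM tsum_mul1E /= mulr1.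
by rewrite -tclsM tsum_mul1E /= mulr1.
Qed.

Lemma tpureE w : tpure w = \prod_(v <- w) tgen v.
Proof. by rewrite /tpure tclsE big_seq1 /= [tscal 1]/(1 : tensalg) mul1r. Qed.

Lemma tensalg_univ (B : pzRingType) (g : {rmorphism k -> B}) (h : V -> B) :
  (forall a b, g a * b = b * g a) -> {morph h : u v / u + v} ->
  (forall a v, h (a *: v) = g a * h v) ->
  exists! F : {rmorphism tensalg -> B},
    (forall a, F (tscal a) = g a) /\ (forall v, F (tgen v) = h v).
Proof.
move=> gC hD hZ.
pose ev (s : tsum) := \sum_(x <- s) g x.1 * \prod_(v <- x.2) h v.
have evD s1 s2 : ev (s1 ++ s2) = ev s1 + ev s2 by rewrite /ev big_cat.
have ev_teq s1 s2 : teq s1 s2 -> ev s1 = ev s2.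
  elim=> // {s1 s2} [s1 s2 s3 _ -> //|s1 s1' s2 s2' _ h1 _ h2|s1 s2|w|a b w
    |a w1 u v w2|a b w1 u w2].
  - by rewrite !evD h1 h2.
  - by rewrite !evD addrC.
  - by rewrite /ev big_seq1 big_nil rmorph0 mul0r.
  - by rewrite /ev !big_cons !big_nil /= !addr0 rmorphD mulrDl.
  - rewrite /ev ![X in X = _]big_seq1 !big_cons big_nil /= addr0.
    by rewrite !big_cat !big_cons /= hD mulrDl !mulrDr.
  - rewrite /ev !big_seq1 /= !big_cat !big_cons /= hZ rmorphM.
    by rewrite -!mulrA [in LHS](mulrA _ (g b)) -(gC b) !mulrA.
have evM s1 s2 : ev (tsum_mul s1 s2) = ev s1 * ev s2.
  elim: s1 => [|x s1 ih]; first by rewrite /ev big_nil mul0r.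
  rewrite tsum_mul_cons evD ih -[x :: s1]cat1s evD mulrDl; congr (_ + _).
  rewrite tsum_mul1E /ev big_map big_seq1 mulr_sumr; apply: eq_bigr => y _ /=.
  rewrite rmorphM big_cat /= -!mulrA; congr (_ * _).
  by rewrite !mulrA -(gC y.1).
pose F (x : tensalg) := ev (repr x).
have FE s : F (tcls s) = ev s by apply/ev_teq/teq_repr.
have F_add : zmod_morphism F.
  move=> x y; apply: (addIr (F y)); rewrite subrK.
  suff FD u v : F (u + v) = F u + F v by rewrite -FD subrK.
  by elim/tens_ind: u => u; elim/tens_ind: v => v; rewrite -tclsD !FE evD.
have F_mon : monoid_morphism F.
  split; first by rewrite [1]/(tcls _) FE /ev big_seq1 rmorph1 big_nil mulr1.
  by elim/tens_ind=> u; elim/tens_ind=> v; rewrite -tclsM !FE evM.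
pose F1 := GRing.isZmodMorphism.Build _ _ F F_add.
pose F2 := GRing.isMonoidMorphism.Build _ _ F F_mon.
pose FF : {rmorphism tensalg -> B} := HB.pack F F1 F2.
exists FF; split.
  split=> [a|v]; rewrite [LHS]FE /ev big_seq1 /= ?big_nil ?mulr1 //.
  by rewrite big_seq1 rmorph1 mul1r.
move=> G [Gg Gh]; apply: rmorphism_ext; elim/tens_ind=> s.
rewrite [LHS]FE tclsE rmorph_sum; apply: eq_bigr => x _.
by rewrite rmorphM rmorph_prod Gg; congr (_ * _); apply: eq_bigr => v _.
Qed.

End TensorAlgebra.

Section DLieAlgebras.
Variables (k A : comPzRingType) (iota : {rmorphism k -> A}).

(* the ring map is a parameter so that the k-action can be inferred *)
Definition restr (_ : {rmorphism k -> A}) (M : lmodType A) : Type := M.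

Section Restr.
Variable M : lmodType A.
HB.instance Definition _ := GRing.Zmodule.on (restr iota M).

Let scalek (t : k) (m : restr iota M) : restr iota M := iota t *: (m : M).
Fact restr_scaleA a b v : scalek a (scalek b v) = scalek (a * b) v.
Proof. by rewrite /scalek scalerA rmorphM. Qed.
Fact restr_scale1 : left_id 1 scalek.
Proof. by move=> v; rewrite /scalek rmorph1 scale1r. Qed.
Fact restr_scaleDr : right_distributive scalek +%R.
Proof. by move=> a u v; rewrite /scalek scalerDr. Qed.
Fact restr_scaleDl v : {morph scalek^~ v : a b / a + b}.
Proof. by move=> a b; rewrite /scalek rmorphD scalerDl. Qed.
HB.instance Definition _ := GRing.Zmodule_isLmodule.Build k (restr iota M)
  restr_scaleA restr_scale1 restr_scaleDr restr_scaleDl.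

Lemma restr_scaleE (t : k) (m : M) : t *: (m : restr iota M) = iota t *: m.
Proof. by []. Qed.
End Restr.

(* An A ⊗_k A-module, given by its commuting left and right A-actions; they
   agree on k because (t ⊗ 1) = (1 ⊗ t) for t in k. *)
Record bimodule := Bimodule {
  bim_left :> lmodType A;
  ract : bim_left -> A -> bim_left;
  ractDl : forall m n a, ract (m + n) a = ract m a + ract n a;
  ractDr : forall m a b, ract m (a + b) = ract m a + ract m b;
  ract1 : forall m, ract m 1 = m;
  ractM : forall m a b, ract m (a * b) = ract (ract m a) b;
  ractZ : forall a m b, ract (a *: m) b = a *: ract m b;
  ractk : forall m t, ract m (iota t) = iota t *: m }.

Definition is_bimodule_hom (M N : bimodule) (phi : M -> N) :=
  linear phi /\ forall m a, phi (ract m a) = ract (phi m) a.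

Definition is_lie_bracket (V : lmodType k) (br : V -> V -> V) :=
  [/\ forall w, linear (br w), forall w, linear (br^~ w), forall u, br u u = 0 &
      forall u v w, br u (br v w) + br v (br w u) + br w (br u v) = 0].

Record lie_bimodule := LieBimodule {
  lie_bim :> bimodule;
  lie : lie_bim -> lie_bim -> lie_bim;
  lieP : is_lie_bracket (lie : restr iota lie_bim -> restr iota lie_bim -> restr iota lie_bim) }.

Definition is_lie_hom (L M : lie_bimodule) (phi : L -> M) :=
  linear (phi : restr iota L -> restr iota M) /\ forall u v, phi (lie u v) = lie (phi u) (phi v).

Record der := Der {
  der_fun :> A -> A;
  derD : {morph der_fun : a b / a + b};
  derk : forall t a, der_fun (iota t * a) = iota t * der_fun a;
  derM : forall a b, der_fun (a * b) = a * der_fun b + b * der_fun a }.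

Lemma der_ext (x y : der) : x =1 y -> x = y.
Proof.
case: x y => [f f1 f2 f3] [g g1 g2 g3] /= /funext eqfg; subst g.
by congr Der; apply: Prop_irrelevance.
Qed.

HB.instance Definition _ := gen_eqMixin der.
HB.instance Definition _ := gen_choiceMixin der.

Definition der_zero : der.
Proof.
by exists (fun=> 0) => [a b|t a|a b] /=; rewrite ?mulr0 ?addr0.
Defined.

Definition der_opp (x : der) : der.
Proof.
exists (fun a => - x a) => [a b|t a|a b].
- by rewrite derD opprD.
- by rewrite derk mulrN.
- by rewrite derM opprD !mulrN.
Defined.

Definition der_add (x y : der) : der.
Proof.
exists (fun a => x a + y a) => [a b|t a|a b].
- by rewrite !derD addrACA.
- by rewrite !derk mulrDr.
- by rewrite !derM !mulrDr addrACA.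
Defined.

Definition der_scale (c : A) (x : der) : der.
Proof.
exists (fun a => c * x a) => [a b|t a|a b].
- by rewrite derD mulrDr.
- by rewrite derk mulrCA.
- by rewrite derM mulrDr [c * (_ * _)]mulrCA [X in _ + X]mulrCA.
Defined.

Fact der_addA : associative der_add.
Proof. by move=> x y z; apply: der_ext => a /=; rewrite addrA. Qed.
Fact der_addC : commutative der_add.
Proof. by move=> x y; apply: der_ext => a /=; rewrite addrC. Qed.
Fact der_add0 : left_id der_zero der_add.
Proof. by move=> x; apply: der_ext => a /=; rewrite add0r. Qed.
Fact der_addN : left_inverse der_zero der_opp der_add.
Proof. by move=> x; apply: der_ext => a /=; rewrite addNr. Qed.
HB.instance Definition _ :=
  GRing.isZmodule.Build der der_addA der_addC der_add0 der_addN.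

Fact der_scaleA a b v : der_scale a (der_scale b v) = der_scale (a * b) v.
Proof. by apply: der_ext => c /=; rewrite mulrA. Qed.
Fact der_scale1 : left_id 1 der_scale.
Proof. by move=> x; apply: der_ext => c /=; rewrite mul1r. Qed.
Fact der_scaleDr : right_distributive der_scale +%R.
Proof. by move=> a u v; apply: der_ext => c /=; rewrite mulrDr. Qed.
Fact der_scaleDl v : {morph der_scale^~ v : a b / a + b}.
Proof. by move=> a b; apply: der_ext => c /=; rewrite mulrDl. Qed.
HB.instance Definition _ := GRing.Zmodule_isLmodule.Build A der
  der_scaleA der_scale1 der_scaleDr der_scaleDl.

Lemma der_addE (x y : der) a : (x + y) a = x a + y a. Proof. by []. Qed.
Lemma der_oppE (x : der) a : (- x) a = - x a. Proof. by []. Qed.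
Lemma der_scaleE c (x : der) a : (c *: x) a = c * x a. Proof. by []. Qed.
Lemma der_zeroE a : (0 : der) a = 0. Proof. by []. Qed.

Lemma derN (x : der) a : x (- a) = - x a.
Proof.
have x0 : x 0 = 0 by apply: (addIr (x 0)); rewrite -derD !add0r.
by apply: (addIr (x a)); rewrite -derD !addNr.
Qed.

Definition der_br (x y : der) : der.
Proof.
exists (fun a => x (y a) - y (x a)) => [a b|t a|a b].
- by rewrite !derD opprD addrACA.
- by rewrite !derk mulrBr.
- by rewrite !derM !derD !derM; ring.
Defined.

Definition der_bim : bimodule.
Proof.
exists (der : lmodType A) (fun x a => a *: x) => *.
- exact: scalerDr.
- exact: scalerDl.
- exact: scale1r.
- by rewrite scalerA mulrC.
- by rewrite !scalerA mulrC.
- by [].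
Defined.

Fact der_lieP : is_lie_bracket (der_br : restr iota der -> restr iota der -> restr iota der).
Proof.
split=> [w t u v|w t u v|u|u v w]; apply: der_ext => a.
- by rewrite /= derD derk; ring.
- by rewrite /= derD derk; ring.
- by rewrite /= subrr.
- by rewrite /= !(derD, derN); ring.
Qed.

Definition der_lie : lie_bimodule := @LieBimodule der_bim der_br der_lieP.

Record cocycle2 := Cocycle2 {
  coc :> der -> der -> A;
  coc_linl : forall z c x y, coc (c *: x + y) z = c * coc x z + coc y z;
  coc_linr : forall z c x y, coc z (c *: x + y) = c * coc z x + coc z y;
  coc_alt : forall x, coc x x = 0;
  coc_cocycle : forall x y z : der,
    x (coc y z) - y (coc x z) + z (coc x y)
      - coc (der_br x y) z + coc (der_br x z) y - coc (der_br y z) x = 0 }.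

(* the pair (a, x) stands for aI + x *)
Definition D1_sort : Type := (A^o * der)%type.
HB.instance Definition _ := GRing.Lmodule.on D1_sort.

Lemma der1 (x : der) : x 1 = 0.
Proof. by apply: (addIr (x 1)); rewrite -{3}[1]mulr1 derM !mul1r add0r. Qed.

Definition D1_bim : bimodule.
Proof.
exists (D1_sort : lmodType A) (fun (u : D1_sort) c => ((u.1 : A) * c + u.2 c, c *: u.2)).
- by move=> [a x] [b y] c; congr pair => /=; [ring|rewrite scalerDr].
- by move=> [a x] b c; congr pair => /=; [rewrite derD; ring|rewrite scalerDl].
- move=> [a x]; congr pair => /=; last by rewrite scale1r.
  by rewrite der1; ring.
- move=> [a x] b c; congr pair => /=; last by rewrite scalerA mulrC.
  by rewrite derM; ring.
- move=> b [a x] c; congr pair => /=; last by rewrite !scalerA mulrC.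
  by rewrite /GRing.scale /=; ring.
- move=> [a x] t; congr pair => /=.
  by rewrite -[X in x X]mulr1 derk der1 mulr0 addr0 mulrC.
Defined.

Section D1.
Variable f : cocycle2.

Definition D1_br (u v : D1_sort) : D1_sort :=
  (u.2 v.1 - v.2 u.1 + f u.2 v.2, der_br u.2 v.2).

Lemma cocDl x y z : f (x + y) z = f x z + f y z.
Proof. by rewrite -[x in LHS]scale1r coc_linl mul1r. Qed.
Lemma cocDr x y z : f z (x + y) = f z x + f z y.
Proof. by rewrite -[x in LHS]scale1r coc_linr mul1r. Qed.
Lemma cocC x y : f x y = - f y x.
Proof.
apply: (addIr (f y x)); rewrite addNr.
by have := coc_alt f (x + y); rewrite cocDl !cocDr !coc_alt add0r addr0.
Qed.

Lemma cocNr z x : f z (- x) = - f z x.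
Proof.
have f0 : f z 0 = 0 by apply: (addIr (f z 0)); rewrite -cocDr !add0r.
by apply: (addIr (f z x)); rewrite -cocDr !addNr.
Qed.

Fact D1_lieP : is_lie_bracket (D1_br : restr iota D1_bim -> restr iota D1_bim -> restr iota D1_bim).
Proof.
have [dl dr da dj] := der_lieP.
split=> [[c w] t [a x] [b y]|[c w] t [a x] [b y]|[a x]|[a x] [b y] [c z]].
- congr pair; last exact: dl.
  by rewrite /= /GRing.scale /= derD derk coc_linr; ring.
- congr pair; last exact: dr.
  by rewrite /= /GRing.scale /= derD derk coc_linl; ring.
- by congr pair; [rewrite /= coc_alt; ring|exact: da].
- congr pair; last exact: dj.
  have := coc_cocycle f x y z; rewrite /= !(derD, derN).
  rewrite (cocC (der_br x y)) (cocC (der_br y z)) (cocC (der_br x z)).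
  have -> : der_br z x = - der_br x z by apply: der_ext => e /=; ring.
  rewrite cocNr.
  rewrite (cocC z x) derN => E; rewrite -[RHS]E; ring.
Qed.

Definition D1 : lie_bimodule := @LieBimodule D1_bim D1_br D1_lieP.

Definition D1_pi (u : D1) : der := (u : D1_sort).2.

Record dlie := DLie {
  dl_lie :> lie_bimodule;
  dl_alpha : dl_lie -> D1;
  dl_pi : dl_lie -> der_lie;
  dl_D : dl_lie;
  dl_alpha_bim : is_bimodule_hom dl_alpha;
  dl_alpha_lie : is_lie_hom dl_alpha;
  dl_pi_bim : is_bimodule_hom dl_pi;
  dl_pi_lie : is_lie_hom dl_pi;
  dl_pi_alpha : forall u, D1_pi (dl_alpha u) = dl_pi u;
  dl_central : forall u, lie dl_D u = 0;
  dl_pi_D : dl_pi dl_D = 0;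
  dl_ract : forall (u : dl_lie) (c : A),
    ract u c = c *: u + (dl_pi u : der) c *: dl_D;
  dl_leibniz : forall (u v : dl_lie) (c : A),
    lie u (c *: v) = c *: lie u v + (dl_pi u : der) c *: v }.

Record dlie_hom (L M : dlie) := DLieHom {
  dlh :> L -> M;
  dlh_bim : is_bimodule_hom dlh;
  dlh_lie : is_lie_hom dlh;
  dlh_alpha : forall u, dl_alpha (dlh u) = dl_alpha u;
  dlh_D : dlh (dl_D L) = dl_D M }.

Lemma dlie_hom_ext (L M : dlie) (p q : dlie_hom L M) : p =1 q -> p = q.
Proof.
case: p q => [p p1 p2 p3 p4] [q q1 q2 q3 q4] /= /funext eqpq; subst q.
by congr DLieHom; apply: Prop_irrelevance.
Qed.

Definition dlie_id (L : dlie) : dlie_hom L L.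
Proof. by exists id. Defined.

Definition dlie_comp (L M N : dlie) (q : dlie_hom M N) (p : dlie_hom L M) :
  dlie_hom L N.
Proof.
exists (fun u => q (p u)).
- by split=> [a u v|u a]; rewrite ?(dlh_bim p).1 ?(dlh_bim q).1 ?(dlh_bim p).2 ?(dlh_bim q).2.
- split=> [a u v|u v].
    by have [+ _] := dlh_lie p; have [+ _] := dlh_lie q => ql pl; rewrite pl ql.
  by rewrite (dlh_lie p).2 (dlh_lie q).2.
- by move=> u; rewrite !dlh_alpha.
- by rewrite !dlh_D.
Defined.

Definition DLieCat : category.
Proof.
exists dlie dlie_hom dlie_id dlie_comp.
- by move=> *; apply: dlie_hom_ext.
- by move=> *; apply: dlie_hom_ext.
- by move=> *; apply: dlie_hom_ext.
Defined.

End D1.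

Record endk (E : lmodType A) := Endk {
  endk_fun :> E -> E;
  endkP : linear (endk_fun : restr iota E -> restr iota E) }.

Section Endk.
Variable E : lmodType A.

Lemma endk_ext (p q : endk E) : p =1 q -> p = q.
Proof.
case: p q => [p p1] [q q1] /= /funext eqpq; subst q.
by congr Endk; apply: Prop_irrelevance.
Qed.

HB.instance Definition _ := gen_eqMixin (endk E).
HB.instance Definition _ := gen_choiceMixin (endk E).

Definition endk_id : endk E.
Proof. by exists id. Defined.

Definition endk_zero : endk E.
Proof. by exists (fun=> 0) => t u v; rewrite scaler0 addr0. Defined.

Definition endk_opp (p : endk E) : endk E.
Proof. by exists (fun e => - p e) => t u v; rewrite endkP opprD scalerN. Defined.

Definition endk_add (p q : endk E) : endk E.
Proof.
by exists (fun e => p e + q e) => t u v; rewrite !endkP scalerDr addrACA.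
Defined.

Definition endk_scale (c : A) (p : endk E) : endk E.
Proof.
exists (fun e => c *: p e) => t u v; rewrite endkP scalerDr; congr (_ + _).
by rewrite !restr_scaleE !scalerA mulrC.
Defined.

Definition endk_ract (p : endk E) (c : A) : endk E.
Proof.
exists (fun e => p (c *: e)) => t u v; rewrite -endkP; congr endk_fun.
by rewrite scalerDr !restr_scaleE !scalerA mulrC.
Defined.

Fact endk_addA : associative endk_add.
Proof. by move=> x y z; apply: endk_ext => a /=; rewrite addrA. Qed.
Fact endk_addC : commutative endk_add.
Proof. by move=> x y; apply: endk_ext => a /=; rewrite addrC. Qed.
Fact endk_add0 : left_id endk_zero endk_add.
Proof. by move=> x; apply: endk_ext => a /=; rewrite add0r. Qed.
Fact endk_addN : left_inverse endk_zero endk_opp endk_add.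
Proof. by move=> x; apply: endk_ext => a /=; rewrite addNr. Qed.
HB.instance Definition _ :=
  GRing.isZmodule.Build (endk E) endk_addA endk_addC endk_add0 endk_addN.

Fact endk_scaleA a b v : endk_scale a (endk_scale b v) = endk_scale (a * b) v.
Proof. by apply: endk_ext => c /=; rewrite scalerA. Qed.
Fact endk_scale1 : left_id 1 endk_scale.
Proof. by move=> x; apply: endk_ext => c /=; rewrite scale1r. Qed.
Fact endk_scaleDr : right_distributive endk_scale +%R.
Proof. by move=> a u v; apply: endk_ext => c /=; rewrite scalerDr. Qed.
Fact endk_scaleDl v : {morph endk_scale^~ v : a b / a + b}.
Proof. by move=> a b; apply: endk_ext => c /=; rewrite scalerDl. Qed.
HB.instance Definition _ := GRing.Zmodule_isLmodule.Build A (endk E)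
  endk_scaleA endk_scale1 endk_scaleDr endk_scaleDl.

Lemma endkD (p : endk E) u v : p (u + v) = p u + p v.
Proof. by rewrite -[u in LHS](scale1r (u : restr iota E)) endkP scale1r. Qed.

Lemma endkZ (p : endk E) t (u : E) : p (iota t *: u) = iota t *: p u.
Proof.
have p0 : p 0 = 0 by apply: (addIr (p 0)); rewrite -endkD !add0r.
by rewrite -[_ *: u]addr0 [LHS]endkP p0 addr0.
Qed.

Definition endk_bim : bimodule.
Proof.
exists (endk E : lmodType A) endk_ract => *; apply: endk_ext => e /=.
- by [].
- by rewrite scalerDl endkD.
- by rewrite scale1r.
- by rewrite scalerA.
- by [].
- exact: endkZ.
Defined.
End Endk.

Section Representations.
Variables (f : cocycle2) (L : dlie f).

Definition is_modId (E : lmodType A) (rho : L -> endk E) :=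
  is_bimodule_hom (rho : L -> endk_bim E) /\ rho (dl_D L) = endk_id E.

Definition is_conn (E : lmodType A) (rho : L -> endk E) :=
  [/\ linear rho, rho (dl_D L) = endk_id E &
      forall x a e, rho x (a *: e) = a *: rho x e + (dl_pi x : der) a *: e].

Section RepCat.
Variable P : forall E : lmodType A, (L -> endk E) -> Prop.

Record rep := Rep {
  rep_mod :> lmodType A;
  rep_rho : L -> endk rep_mod;
  rep_P : P rep_rho }.

Record rep_hom (E E' : rep) := RepHom {
  rep_map :> {linear E -> E'};
  rep_comm : forall u e, rep_map (rep_rho E u e) = rep_rho E' u (rep_map e) }.

Lemma rep_hom_ext (E E' : rep) (p q : rep_hom E E') : p =1 q -> p = q.
Proof.
case: p q => [p p1] [q q1] /= /linear_ext eqpq; subst q.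
by congr RepHom; apply: Prop_irrelevance.
Qed.

Definition rep_id (E : rep) : rep_hom E E.
Proof. by exists idfun. Defined.

Definition rep_comp (E E' E'' : rep) (q : rep_hom E' E'') (p : rep_hom E E') :
  rep_hom E E''.
Proof. by exists (rep_map q \o rep_map p) => u e /=; rewrite !rep_comm. Defined.

Definition RepCat : category.
Proof.
exists rep rep_hom rep_id rep_comp.
- by move=> *; apply: rep_hom_ext.
- by move=> *; apply: rep_hom_ext.
- by move=> *; apply: rep_hom_ext.
Defined.

Definition Rep_forget : functor RepCat Ab.
Proof.
exists (fun E : rep => E : zmodType).
exists (fun (E E' : rep) (p : rep_hom E E') => rep_map p : {additive E -> E'}).
- by move=> E; apply: additive_ext.
- by move=> *; apply: additive_ext.
Defined.
End RepCat.

Definition ModId : category := RepCat is_modId.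
Definition Conn : category := RepCat is_conn.
Definition ModId_forget : functor ModId Ab := Rep_forget is_modId.
Definition Conn_forget : functor Conn Ab := Rep_forget is_conn.

Local Notation T := (tensalg (restr iota L)).
Local Notation "[ u ]" := (tgen ((u : L) : restr iota L)).
Local Notation D := (dl_D L).

Inductive J1_gen : T -> Prop :=
| J1_D : J1_gen ([D] - 1)
| J1_left (a : A) (u : L) : J1_gen ([a *: u] - [a *: D] * [u])
| J1_right (b : A) (v : L) : J1_gen ([ract v b] - [v] * [b *: D]).

Inductive J2_gen : T -> Prop :=
| J2_D : J2_gen ([D] - 1)
| J2_left (a : A) (u : L) : J2_gen ([a *: u] - [a *: D] * [u])
| J2_conn (b : A) (v : L) :
    J2_gen ([v] * [b *: D] - [b *: D] * [v] - [(dl_pi v : der) b *: D]).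

Definition Uotimes : pzRingType := quot_ring J1_gen.
Definition Urho : pzRingType := quot_ring J2_gen.

Definition Uotimes_cls (s : seq L) : Uotimes := quot_cls J1_gen (tpure (s : seq (restr iota L))).
Definition Urho_cls (s : seq L) : Urho := quot_cls J2_gen (tpure (s : seq (restr iota L))).

End Representations.
End DLieAlgebras.

(* Main.v *)
(** A linear map rho : L -> End_k(E) extends uniquely to the tensor algebra, and
the relations generating J_1 (resp. J_2) hold in End_k(E) exactly when
rho(D) = Id and rho is right A-linear (resp. satisfies the Leibniz rule). So
E becomes a module over the quotient. Conversely a module M over the quotient
becomes an A-module by a m = (aD) m: the relations D = 1 and
au = (aD) u make this an action for which u |-> (m |-> u m) is left A-linear.
Neither construction changes the underlying abelian group or the underlying
maps, hence exactness; injective and projective objects are preserved by any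
equivalence of categories. *)
From HB Require Import structures.
From mathcomp Require Import all_boot all_algebra.
From mathcomp Require Import boolp.
Require Import Defs.

Set Implicit Arguments.
Unset Strict Implicit.
Unset Printing Implicit Defensive.

Section Equivalences.
Import GRing.Theory.
Local Open Scope ring_scope.

(** * Equivalences of categories, injective and projective objects *)

Definition op_category (C : category) : category.
Proof.
exists C (fun X Y : C => hom Y X) (fun X => idm X)
  (fun X Y Z (g : hom Z Y) (f : hom Y X) => comp f g).
- by move=> *; rewrite compA.
- by move=> *; rewrite compm1.
- by move=> *; rewrite comp1m.
Defined.

Definition op_functor (C D : category) (F : functor C D) :
  functor (op_category C) (op_category D).
Proof.
refine (@Functor (op_category C) (op_category D) (@fobj C D F) _).
exists (fun (X Y : op_category C) (f : hom X Y) => fmap F (f : @hom C Y X)).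
  by move=> X; exact: (@fmap_id C D F F).
by move=> X Y Z g f; exact: (@fmap_comp C D F F).
Defined.

(** Choice selects an inverse of each component. Naturality of the inverses follows by inserting
    [comp (t X) (s X)], moving [t] across by its own naturality and cancelling. *)
Lemma natural_inverse (C D : category) (F G : functor C D) :
  naturally_isomorphic F G ->
  exists (t : forall X, hom (F X) (G X)) (s : forall X, hom (G X) (F X)),
    [/\ forall X, comp (s X) (t X) = idm _, forall X, comp (t X) (s X) = idm _,
        forall X Y (f : hom X Y), comp (t Y) (fmap F f) = comp (fmap G f) (t X) &
        forall X Y (f : hom X Y), comp (s Y) (fmap G f) = comp (fmap F f) (s X)].
Proof.
move=> [t [tiso tnat]].
have [s sP] : exists s : forall X, hom (G X) (F X), forall X,
    comp (s X) (t X) = idm _ /\ comp (t X) (s X) = idm _.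
  by exists (fun X => sval (cid (tiso X))) => X; case: cid.
have st X := proj1 (sP X); have ts X := proj2 (sP X).
exists t, s.
split=> // X Y f; rewrite -[LHS]compm1 -(ts X) compA -[X in comp X _]compA -tnat.
by rewrite compA st comp1m.
Qed.

(** Reversing arrows turns the inverse transformations [s] and [s'] into the required natural
    isomorphisms. *)
Lemma equivalence_op (C D : category) (F : functor C D) :
  is_equivalence F -> is_equivalence (op_functor F).
Proof.
move=> [G [/natural_inverse [t [s [st ts tn sn]]] /natural_inverse [t' [s' [st' ts' tn' sn']]]]].
exists (op_functor G); split.
  exists s; split=> [X|X Y g]; first by exists (t X); split; [apply: st|apply: ts].
  by symmetry; apply: (sn _ _ (g : @hom C Y X)).
exists s'; split=> [X|X Y g]; first by exists (t' X); split; [apply: st'|apply: ts'].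
by symmetry; apply: (sn' _ _ (g : @hom D Y X)).
Qed.

Lemma equivalence_injectives (C D : category) (F : functor C D) :
  is_equivalence F -> preserves_injectives F.
Proof.
move=> [G [/natural_inverse [t [s [st ts tn sn]]] /natural_inverse [t' [s' [st' ts' tn' sn']]]]].
(* Conjugating GF(g) by the isomorphisms [t] recovers g, so F(g) determines g. *)
have faithful X Y (g h : @hom C X Y) : fmap F g = fmap F h -> g = h.
  move=> gh; rewrite -[g]compm1 -[h]compm1 -(ts X) !compA.
  by have /= <- := tn _ _ g; have /= <- := tn _ _ h; rewrite gh.
move=> I injI X Y i p mono_i.
(* By faithfulness, F(g) and F(h) may be compared instead, after composition with the isomorphism
   [t' X]; naturality of [t'] then reduces the claim to [i] being mono. *)
have mono_Gi : monomorphism (fmap G i).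
  move=> Z g h gh; apply: faithful.
  suff E : comp (t' X) (fmap F g) = comp (t' X) (fmap F h).
    by rewrite -[LHS]comp1m -[RHS]comp1m -(st' X) -!compA E.
  apply: mono_i; rewrite !compA; have /= <- := tn' _ _ i.
  by rewrite -!compA -!fmap_comp gh.
have [q qE] := injI _ _ _ (comp (t I) (fmap G p)) mono_Gi.
(* The detour through FGF(I) avoids any triangle identity between [t] and [t']: F([s I]) cancels the
   F([t I]) brought in by [qE], and [t'] cancels [s'] at F(I). *)
exists (comp (comp (t' (F I)) (fmap F (s I))) (comp (fmap F q) (s' Y))).
rewrite -!compA; have /= -> := sn' _ _ i; rewrite /= [comp (fmap F q) _]compA.
rewrite -fmap_comp qE fmap_comp -compA; have /= <- := sn' _ _ p.
rewrite [comp (fmap F (s I)) _]compA -fmap_comp st fmap_id comp1m compA ts'.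
exact: comp1m.
Qed.

(** Projective objects are the injective objects of the opposite category, so this is the previous
    result for [op_functor F]. *)
Lemma equivalence_projectives (C D : category) (F : functor C D) :
  is_equivalence F -> preserves_projectives F.
Proof.
move=> /equivalence_op/equivalence_injectives injF P projP X Y.
by apply: (injF P) => X' Y'; apply: projP.
Qed.

(** * Maps out of quotient rings; bundling of linear maps *)

Lemma quot_cls_rel (R : pzRingType) (S : R -> Prop) (x y : R) :
  S (x - y) -> quot_cls S x = quot_cls S y.
Proof. by move=> Sxy; apply/quot_clsP => I _; apply. Qed.

(** The kernel of [F] is a two-sided ideal containing [S], hence contains the ideal generated by
    [S]; evaluating [F] on representatives is therefore well defined. *)
Lemma quot_lift (R B : pzRingType) (S : R -> Prop) (F : {rmorphism R -> B}) :
  (forall s, S s -> F s = 0) ->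
  exists G : {rmorphism quot_ring S -> B}, forall x, G (quot_cls S x) = F x.
Proof.
move=> FS.
have Fgen x : ideal_gen S x -> F x = 0.
  move=> /(_ (fun x => F x = 0)); apply=> //; split=> [|a b Fa Fb|a b Fb].
  - exact: rmorph0.
  - by rewrite rmorphB Fa Fb subrr.
  - by rewrite !rmorphM Fb mulr0 mul0r.
pose G (q : quot_ring S) := F (repr q).
have GE x : G (quot_cls S x) = F x.
  apply/eqP; rewrite -subr_eq0 -rmorphB; apply/eqP/Fgen/quot_clsP.
  by rewrite /quot_cls reprK.
have G_add : zmod_morphism G.
  elim/quot_ind=> x; elim/quot_ind=> y.
  by rewrite -rmorphB !GE rmorphB.
have G_mon : monoid_morphism G.
  split; first by rewrite -[1]/(quot_cls S 1) GE rmorph1.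
  elim/quot_ind=> x; elim/quot_ind=> y.
  by rewrite -rmorphM !GE rmorphM.
pose G1 := GRing.isZmodMorphism.Build _ _ G G_add.
pose G2 := GRing.isMonoidMorphism.Build _ _ G G_mon.
by exists (HB.pack G G1 G2 : {rmorphism _ -> _}) => x; apply: GE.
Qed.

Definition linear_of (R : pzRingType) (U V : lmodType R) (p : U -> V)
  (p_lin : linear p) : {linear U -> V} :=
  HB.pack p (GRing.isLinear.Build R U V *:%R p p_lin).

(** * Generators of the tensor algebra and of its quotients *)

Section TensorAlgebra.
Variables (k : comPzRingType) (V : lmodType k).

Lemma tgenD (u v : V) : tgen (u + v) = tgen u + tgen v.
Proof.
rewrite -tclsD; apply/tclsP; exact: (teq_tensD 1 [::] u v [::]).
Qed.

Lemma tgenZ t (v : V) : tgen (t *: v) = tscal V t * tgen v.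
Proof.
rewrite -tclsM; apply/tclsP; rewrite tsum_mul1E /= mulr1.
by rewrite -[X in teq _ [:: (X, _)]]mul1r; apply: (teq_tensZ 1 t [::] v [::]).
Qed.

Fact tscal_additive : zmod_morphism (tscal V).
Proof.
move=> a b; apply: (addIr (tscal V b)); rewrite subrK -tclsD.
by apply/esym/tclsP; rewrite -{1}[a](subrK b); apply: teq_coefD.
Qed.
Fact tscal_monoid : monoid_morphism (tscal V).
Proof. by split=> // a b; rewrite -tclsM. Qed.
HB.instance Definition _ := GRing.isZmodMorphism.Build _ _ (tscal V) tscal_additive.
HB.instance Definition _ := GRing.isMonoidMorphism.Build _ _ (tscal V) tscal_monoid.

Lemma tscalC t x : tscal V t * x = x * tscal V t.
Proof.
elim/tens_ind: x => s; rewrite -!tclsM tsum_mul1E /=; congr tcls.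
elim: s => //= -[a w] s ih; rewrite tsum_mul_cons ih tsum_mul1E /=.
by rewrite mulrC cats0.
Qed.

(** The scalars from k and the vectors generate the tensor algebra as a ring, by [tclsE]. This
    uniqueness later yields the functor laws. *)
Lemma quot_tensalg_ext (S : tensalg V -> Prop) (B : pzRingType)
    (F G : {rmorphism quot_ring S -> B}) :
  (forall t, F (quot_cls S (tscal V t)) = G (quot_cls S (tscal V t))) ->
  (forall v, F (quot_cls S (tgen v)) = G (quot_cls S (tgen v))) -> F = G.
Proof.
move=> FGk FGv; apply: rmorphism_ext; elim/quot_ind=> x; elim/tens_ind: x => s.
rewrite tclsE !rmorph_sum; apply: eq_bigr => -[t w] _ /=.
rewrite !rmorphM FGk !rmorph_prod; congr (_ * _).
by apply: eq_bigr => v _; apply: FGv.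
Qed.

End TensorAlgebra.

(** * The ring of k-linear endomorphisms under composition *)

Section EndomorphismRing.
Variables (k A : comPzRingType) (iota : {rmorphism k -> A}) (E : lmodType A).

Definition endk_comp (p q : endk iota E) : endk iota E.
Proof. by exists (fun e => p (q e)) => t u v; rewrite !endkP. Defined.

Fact endk_compA : associative endk_comp.
Proof. by move=> p q r; apply: endk_ext. Qed.
Fact endk_comp1l : left_id (endk_id iota E) endk_comp.
Proof. by move=> p; apply: endk_ext. Qed.
Fact endk_comp1r : right_id (endk_id iota E) endk_comp.
Proof. by move=> p; apply: endk_ext. Qed.
Fact endk_compDl : left_distributive endk_comp +%R.
Proof. by move=> p q r; apply: endk_ext. Qed.
Fact endk_compDr : right_distributive endk_comp +%R.
Proof. by move=> p q r; apply: endk_ext => e /=; rewrite endkD. Qed.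
HB.instance Definition _ := GRing.Zmodule_isPzRing.Build (endk iota E)
  endk_compA endk_comp1l endk_comp1r endk_compDl endk_compDr.

(** The structure map from k to End_k(E), needed as input to [tensalg_univ]; its image is central
    because endomorphisms are k-linear. *)
Definition endk_scalar (t : k) : endk iota E := iota t *: endk_id iota E.

Fact endk_scalar_additive : zmod_morphism endk_scalar.
Proof. by move=> a b; rewrite /endk_scalar rmorphB scalerBl. Qed.
Fact endk_scalar_monoid : monoid_morphism endk_scalar.
Proof.
rewrite /endk_scalar; split=> [|a b]; first by rewrite rmorph1 scale1r.
by apply: endk_ext => e /=; rewrite rmorphM scalerA.
Qed.
HB.instance Definition _ :=
  GRing.isZmodMorphism.Build _ _ endk_scalar endk_scalar_additive.
HB.instance Definition _ :=
  GRing.isMonoidMorphism.Build _ _ endk_scalar endk_scalar_monoid.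

End EndomorphismRing.

(** * Representations of L as modules over a quotient of the tensor algebra *)

Section RepresentationEquivalence.
Variables (k A : comPzRingType) (iota : {rmorphism k -> A}).
Variables (f : cocycle2 iota) (L : dlie f).
Local Notation T := (tensalg (restr iota L)).
Local Notation "[ u ]" := (tgen ((u : L) : restr iota L)).
Local Notation D := (dl_D L).

(** One argument covers both equivalences: [P] and [S] stand for [is_modId] and [J1_gen], or for
    [is_conn] and [J2_gen]. The hypothesis [P_relations] serves in both directions: it lets [rho]
    descend to the quotient, and it shows that a module over the quotient gives back a
    representation. *)
Variable P : forall E : lmodType A, (L -> endk iota E) -> Prop.
Variable S : T -> Prop.
Hypothesis P_linear : forall E (rho : L -> endk iota E), P rho -> linear rho.
Hypothesis P_relations :
  forall E (rho : L -> endk iota E) (F : {rmorphism T -> endk iota E}),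
  (forall u, F [u] = rho u) -> linear rho ->
  P rho <-> forall s, S s -> F s = 0.
Hypothesis S_D : S ([D] - 1).
Hypothesis S_left : forall a u, S ([a *: u] - [a *: D] * [u]).

Local Notation U := (quot_ring S).
Local Notation gen u := (quot_cls S [u]).

Lemma gen_D : gen D = 1.
Proof. exact: quot_cls_rel. Qed.

Lemma gen_left a u : gen (a *: u) = gen (a *: D) * gen u.
Proof. by rewrite -rmorphM; apply: quot_cls_rel. Qed.

Lemma gen_add u v : gen (u + v) = gen u + gen v.
Proof. by rewrite -rmorphD -tgenD. Qed.

(* Since D = 1 in U, the scalars from k are redundant as ring generators. *)
Lemma gen_scal t : gen (iota t *: D) = quot_cls S (tscal _ t).
Proof.
by rewrite -[RHS]mulr1 -gen_D -rmorphM -tgenZ.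
Qed.

(** By [gen_scal], each element of [U] is a sum of products of classes of elements of L, so
    compatibility with these classes suffices. *)
Lemma scalable_of_gen (M N : lmodType U) (phi : {additive M -> N}) :
  (forall u m, phi (gen u *: m) = gen u *: phi m) -> scalable phi.
Proof.
move=> phi_gen x m; elim/quot_ind: x => x; elim/tens_ind: x => s.
rewrite tclsE rmorph_sum !scaler_suml raddf_sum; apply: eq_bigr => -[t w] _ /=.
rewrite rmorphM /= -gen_scal -!scalerA phi_gen; congr (_ *: _).
elim: w => [|v w ih]; first by rewrite big_nil rmorph1 !scale1r.
by rewrite big_cons rmorphM /= -!scalerA phi_gen ih.
Qed.

Definition linear_of_gen (M N : lmodType U) (phi : {additive M -> N})
    (phi_gen : forall u m, phi (gen u *: m) = gen u *: phi m) : {linear M -> N} :=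
  HB.pack (phi : M -> N) (GRing.Additive.on phi)
    (GRing.isScalable.Build U M N *:%R phi (scalable_of_gen phi_gen)).

(** The universal property extends [rho] to the tensor algebra; the extension kills [S] by
    [P_relations], so it descends to [U]. *)
Lemma rep_action (E : rep P) :
  exists F : {rmorphism U -> endk iota E}, forall u, F (gen u) = rep_rho E u.
Proof.
case: E => E rho Prho /=; have rho_lin := P_linear Prho.
have [|u v|t u|F [[_ Fgen] _]] := @tensalg_univ k (restr iota L) (endk iota E)
    (@endk_scalar k A iota E) rho.
- move=> t p; apply: endk_ext => e; symmetry; exact: endkZ.
- by have := rho_lin 1 u v; rewrite !scale1r.
- have /= -> := linearZ_LR (linear_of rho_lin) (iota t) u.
  exact: endk_ext.
have [G GE] := quot_lift ((P_relations Fgen rho_lin).1 Prho).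
by exists G => u; rewrite GE Fgen.
Qed.

Definition rep_act (E : rep P) : {rmorphism U -> endk iota E} :=
  sval (cid (rep_action E)).

Lemma rep_act_gen (E : rep P) u : rep_act E (gen u) = rep_rho E u.
Proof. exact: (svalP (cid (rep_action E))). Qed.

(* A copy of the carrier that does not inherit the A-module structure, so that
   it can be given the structure of a U-module. *)
Definition rep_carrier (E : rep P) : Type := rep_mod E.
HB.instance Definition _ (E : rep P) := GRing.Zmodule.on (rep_carrier E).

Section RepToModule.
Variable E : rep P.
Let scale (x : U) (e : rep_carrier E) : rep_carrier E := rep_act E x e.

Fact rep_scaleA a b v : scale a (scale b v) = scale (a * b) v.
Proof. by rewrite /scale rmorphM. Qed.
Fact rep_scale1 : left_id 1 scale.
Proof. by move=> v; rewrite /scale rmorph1. Qed.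
Fact rep_scaleDr : right_distributive scale +%R.
Proof. by move=> a u v; apply: endkD. Qed.
Fact rep_scaleDl v : {morph scale^~ v : a b / a + b}.
Proof. by move=> a b; rewrite /scale rmorphD. Qed.

Definition module_of_rep : lmodType U :=
  HB.pack (rep_carrier E) (GRing.Zmodule_isLmodule.Build U (rep_carrier E)
    rep_scaleA rep_scale1 rep_scaleDr rep_scaleDl).

Lemma module_of_rep_gen u (e : module_of_rep) : gen u *: e = rep_rho E u e.
Proof. by rewrite -rep_act_gen. Qed.

End RepToModule.

Section ModuleToRep.
Variable M : lmodType U.
Definition mod_carrier : Type := M.
HB.instance Definition _ := GRing.Zmodule.on mod_carrier.
Let scale (a : A) (m : mod_carrier) : mod_carrier := gen (a *: D) *: (m : M).

(** The relation au = (aD) u at u = bD gives (abD) = (aD)(bD) in [U]. *)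
Fact mod_scaleA a b v : scale a (scale b v) = scale (a * b) v.
Proof. by rewrite /scale scalerA -gen_left scalerA. Qed.
Fact mod_scale1 : left_id 1 scale.
Proof. by move=> v; rewrite /scale scale1r gen_D; apply: (scale1r (v : M)). Qed.
Fact mod_scaleDr : right_distributive scale +%R.
Proof. by move=> a u v; apply: scalerDr. Qed.
Fact mod_scaleDl v : {morph scale^~ v : a b / a + b}.
Proof. by move=> a b; rewrite /scale scalerDl gen_add; apply: scalerDl. Qed.

Definition module_restr : lmodType A :=
  HB.pack mod_carrier (GRing.Zmodule_isLmodule.Build A mod_carrier
    mod_scaleA mod_scale1 mod_scaleDr mod_scaleDl).

Lemma module_restrE a (m : module_restr) : a *: m = gen (a *: D) *: (m : M).
Proof. by []. Qed.

(** Multiplication by [x] is k-linear because t in k acts through [tscal], whose values are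
    central. *)
Definition mod_act (x : T) : endk iota module_restr.
Proof.
exists (fun m : M => quot_cls S x *: m) => t u v.
rewrite scalerDr; congr (_ + _); rewrite !restr_scaleE !module_restrE.
by rewrite !scalerA gen_scal -!rmorphM tscalC.
Defined.

Fact mod_act_additive : zmod_morphism mod_act.
Proof. by move=> x y; apply: endk_ext => m; rewrite /= rmorphB; apply: scalerBl. Qed.
Fact mod_act_monoid : monoid_morphism mod_act.
Proof.
split=> [|x y]; apply: endk_ext => m /=; first by rewrite rmorph1; apply: scale1r.
by rewrite rmorphM; apply/esym/scalerA.
Qed.
HB.instance Definition _ := GRing.isZmodMorphism.Build _ _ mod_act mod_act_additive.
HB.instance Definition _ := GRing.isMonoidMorphism.Build _ _ mod_act mod_act_monoid.

Definition mod_rho (u : L) : endk iota module_restr := mod_act [u].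

(** The ring map [mod_act] factors through [U], hence kills [S], and [P_relations] applies from
    right to left. Left A-linearity of [mod_rho] is [gen_left]. *)
Lemma mod_rhoP : P mod_rho.
Proof.
apply/(@P_relations _ _ mod_act) => // [a u v|s Ss]; apply: endk_ext => m /=.
  by rewrite gen_add gen_left scalerDl -scalerA.
rewrite (@quot_cls_rel _ _ s 0) ?subr0 // rmorph0; exact: scale0r.
Qed.

Definition rep_of_module : rep P := Rep mod_rhoP.

End ModuleToRep.

(** * The two functors, the equivalence and its exactness *)

Definition rep_functor : functor (RepCat P) (LMod U).
Proof.
refine (@Functor (RepCat P) (LMod U) module_of_rep _).
unshelve refine (@FunctorOn (RepCat P) (LMod U) module_of_rep
  (fun (X Y : rep P) (p : rep_hom X Y) =>
     @linear_of_gen (module_of_rep X) (module_of_rep Y)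
       (rep_map p : {additive _ -> _}) _) _ _).
- by move=> u m; rewrite !module_of_rep_gen; apply: rep_comm.
- by move=> X; apply: linear_ext.
- by move=> X Y Z g h; apply: linear_ext.
Defined.

(** Since a acts through the class of aD, U-linearity at that element is A-linearity. *)
Definition restr_linear (M N : lmodType U) (p : {linear M -> N}) :
  {linear module_restr M -> module_restr N} :=
  HB.pack (p : module_restr M -> module_restr N)
    (GRing.isZmodMorphism.Build (module_restr M) (module_restr N) p (raddfB p))
    (GRing.isScalable.Build A (module_restr M) (module_restr N) *:%R p
      (fun a m => linearZ_LR p _ _)).

Definition module_functor : functor (LMod U) (RepCat P).
Proof.
refine (@Functor (LMod U) (RepCat P) rep_of_module _).
unshelve refine (@FunctorOn (LMod U) (RepCat P) rep_of_module
  (fun (M N : lmodType U) (p : {linear M -> N}) =>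
     @RepHom _ _ _ _ _ _ (rep_of_module M) (rep_of_module N) (restr_linear p) _) _ _).
- by move=> u m /=; apply: linearZ_LR.
- by move=> X; apply: rep_hom_ext.
- by move=> X Y Z g h; apply: rep_hom_ext.
Defined.

(** Both round trips keep the underlying abelian group, so the natural isomorphisms are identity
    maps; only the scalar actions have to be compared. *)
Lemma rep_functor_equivalence : is_equivalence rep_functor.
Proof.
(* After the round trip a acts as [rho](aD), which is a [rho](D) = a Id. *)
have restrE (X : rep P) (a : A) (e : X) :
    (a *: (e : module_restr (module_of_rep X)) : X) = a *: e.
  rewrite module_restrE module_of_rep_gen.
  have /= -> := linearZ_LR (linear_of (P_linear (rep_P X))) a D.
  by rewrite /= -rep_act_gen gen_D rmorph1.
exists module_functor; split.
  have idl (X : rep P) : linear (id : module_restr (module_of_rep X) -> X).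
    by move=> a u v; rewrite restrE.
  have idr (X : rep P) : linear (id : X -> module_restr (module_of_rep X)).
    by move=> a u v; rewrite -restrE.
  unshelve refine (ex_intro _ (fun X : rep P =>
    @RepHom _ _ _ _ _ _ (rep_of_module (module_of_rep X)) X
      (linear_of (idl X)) _) _).
    by move=> u e; apply: module_of_rep_gen.
  split=> [X|X Y p]; last by apply: rep_hom_ext.
  unshelve refine (ex_intro _ (@RepHom _ _ _ _ _ _ X
    (rep_of_module (module_of_rep X)) (linear_of (idr X)) _) _).
    by move=> u e; symmetry; apply: module_of_rep_gen.
  by split; apply: rep_hom_ext.
(* On the module side the actions are compared on generators only; [linear_of_gen] extends the
   agreement to all of [U]. *)
have id_gen (M : lmodType U) u (m : M) :
    gen u *: (m : module_of_rep (rep_of_module M)) = gen u *: m.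
  exact: module_of_rep_gen.
pose idl (M : lmodType U) := @linear_of_gen (module_of_rep (rep_of_module M)) M
  (idfun : {additive M -> M}) (@id_gen M).
pose idr (M : lmodType U) := @linear_of_gen M (module_of_rep (rep_of_module M))
  (idfun : {additive M -> M}) (fun u m => esym (@id_gen M u m)).
exists idl; split=> [M|M N p]; last exact: linear_ext.
by exists (idr M); split; apply: linear_ext.
Qed.

(** The functor leaves underlying groups and maps unchanged up to conversion, so each conclusion is
    its hypothesis. *)
Lemma rep_functor_exact :
  exact_functor (Rep_forget P) (LMod_forget U) rep_functor.
Proof. by split. Qed.

End RepresentationEquivalence.

(** * Functoriality of the enveloping rings *)

Section EnvelopeFunctors.
Variables (k A : comPzRingType) (iota : {rmorphism k -> A}) (f : cocycle2 iota).

Lemma dlie_homZ (L M : dlie f) (phi : dlie_hom L M) a u :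
  phi (a *: u) = a *: phi u.
Proof. exact: (linearZ_LR (linear_of (dlh_bim phi).1)). Qed.

(** The anchor [dl_pi] is the projection of [dl_alpha], which morphisms preserve. *)
Lemma dlie_hom_pi (L M : dlie f) (phi : dlie_hom L M) u :
  dl_pi (phi u) = dl_pi u.
Proof. by rewrite -!dl_pi_alpha dlh_alpha. Qed.

(** The extension of [phi] to tensor algebras carries relations to relations and so descends.
    Identities and composites are respected because both sides agree on generators. *)
Lemma envelope_functor (S : forall L : dlie f, tensalg (restr iota L) -> Prop) :
  (forall (L M : dlie f) (phi : dlie_hom L M)
     (F : {rmorphism tensalg (restr iota L) -> tensalg (restr iota M)}),
     (forall u : L, F (tgen (u : restr iota L)) = tgen (phi u : restr iota M)) ->
     forall s, S L s -> S M (F s)) ->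
  exists U : functor_on (C := DLieCat f) (D := RingCat)
      (fun L : dlie f => quot_ring (@S L) : pzRingType),
    forall (L M : dlie f) (phi : dlie_hom L M) (s : seq L),
      (fmap U phi : {rmorphism quot_ring (@S L) -> quot_ring (@S M)})
        (quot_cls (@S L) (tpure (s : seq (restr iota L)))) =
      quot_cls (@S M) (tpure (map phi s : seq (restr iota M))).
Proof.
move=> S_map.
have lift (L M : dlie f) (phi : dlie_hom L M) :
    exists G : {rmorphism quot_ring (@S L) -> quot_ring (@S M)},
      (forall t, G (quot_cls _ (tscal _ t)) = quot_cls _ (tscal _ t)) /\
      (forall u : L, G (quot_cls _ (tgen (u : restr iota L))) =
        quot_cls _ (tgen (phi u : restr iota M))).
  have [|u v|t u|F [[Fk Fgen] _]] := @tensalg_univ k (restr iota L)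
    (tensalg (restr iota M)) (tscal _) (fun u => tgen (phi u : restr iota M)).
  - exact: tscalC.
  - rewrite -tgenD; congr tgen; exact: (raddfD (linear_of (dlh_bim phi).1)).
  - rewrite -tgenZ; congr tgen; exact: dlie_homZ.
  have [|G GE] := @quot_lift _ _ (@S L)
    (quot_cls (@S M) \o F : {rmorphism _ -> _}).
    move=> s /(S_map _ _ _ _ Fgen) SFs /=.
    by rewrite -(rmorph0 (quot_cls (@S M))); apply: quot_cls_rel; rewrite subr0.
  by exists G; split=> [t|u]; rewrite GE /= ?Fk ?Fgen.
(* Choice turns the separate existence statements into one family; its values on generators are all
   that is used below. *)
have [G GP] : exists G : forall (L M : dlie f) (phi : dlie_hom L M),
    {rmorphism quot_ring (@S L) -> quot_ring (@S M)}, forall L M phi,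
      (forall t, G L M phi (quot_cls _ (tscal _ t)) = quot_cls _ (tscal _ t)) /\
      (forall u : L, G L M phi (quot_cls _ (tgen (u : restr iota L))) =
        quot_cls _ (tgen (phi u : restr iota M))).
  by exists (fun L M phi => sval (cid (lift L M phi))) => L M phi; case: cid.
have Gk L M phi := proj1 (GP L M phi); have Ggen L M phi := proj2 (GP L M phi).
unshelve refine (ex_intro _ (@FunctorOn (DLieCat f) RingCat
  (fun L : dlie f => quot_ring (@S L) : pzRingType) G _ _) _).
- by move=> L; apply: quot_tensalg_ext => [t|v]; rewrite ?Gk ?Ggen.
- move=> L M N q p; apply: quot_tensalg_ext => [t|v] /=.
    by rewrite !Gk.
  by rewrite !Ggen.
move=> L M phi s /=; rewrite !tpureE !rmorph_prod big_map.
by apply: eq_bigr => u _; apply: Ggen.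
Qed.

Lemma J1_gen_map (L M : dlie f) (phi : dlie_hom L M)
    (F : {rmorphism tensalg (restr iota L) -> tensalg (restr iota M)}) :
  (forall u : L, F (tgen (u : restr iota L)) = tgen (phi u : restr iota M)) ->
  forall s, J1_gen s -> J1_gen (F s).
Proof.
move=> Fgen s [|a u|b v].
- by rewrite rmorphB rmorph1 Fgen dlh_D; apply: J1_D.
- by rewrite rmorphB rmorphM !Fgen !dlie_homZ dlh_D; apply: J1_left.
- rewrite rmorphB rmorphM !Fgen dlie_homZ dlh_D (dlh_bim phi).2.
  exact: J1_right.
Qed.

Lemma J2_gen_map (L M : dlie f) (phi : dlie_hom L M)
    (F : {rmorphism tensalg (restr iota L) -> tensalg (restr iota M)}) :
  (forall u : L, F (tgen (u : restr iota L)) = tgen (phi u : restr iota M)) ->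
  forall s, J2_gen s -> J2_gen (F s).
Proof.
move=> Fgen s [|a u|b v].
- by rewrite rmorphB rmorph1 Fgen dlh_D; apply: J2_D.
- by rewrite rmorphB rmorphM !Fgen !dlie_homZ dlh_D; apply: J2_left.
- rewrite !rmorphB !rmorphM !Fgen !dlie_homZ dlh_D -(dlie_hom_pi phi).
  exact: J2_conn.
Qed.

(** * The relations of each presentation as conditions on representations *)

Section Presentations.
Variable L : dlie f.
Local Notation T := (tensalg (restr iota L)).
Local Notation "[ u ]" := (tgen ((u : L) : restr iota L)).

(** Once [rho](D) = Id, linearity makes [rho](bD) multiplication by b. The left relations then hold
    automatically, and the right ones say that [rho](vb) is [rho](v) precomposed with b. *)
Lemma modId_relations (E : lmodType A) (rho : L -> endk iota E)
    (F : {rmorphism T -> endk iota E}) :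
  (forall u, F [u] = rho u) -> linear rho ->
  is_modId rho <-> forall s, J1_gen s -> F s = 0.
Proof.
move=> Fgen rho_lin; have /= rhoZ := linearZ_LR (linear_of rho_lin).
split=> [[[_ rho_ract] rho_D] s [|a u|b v]|FJ].
- by rewrite rmorphB rmorph1 Fgen rho_D subrr.
- rewrite rmorphB rmorphM !Fgen !rhoZ /= rho_D; apply/eqP.
  by rewrite subr_eq0; apply/eqP/endk_ext.
- rewrite rmorphB rmorphM !Fgen !rhoZ /= rho_D rho_ract; apply/eqP.
  by rewrite subr_eq0; apply/eqP/endk_ext.
have rho_D : rho (dl_D L) = endk_id iota E.
  by apply/eqP; rewrite -subr_eq0 -Fgen -(FJ _ (J1_D L)) rmorphB rmorph1.
split=> //; split=> // v b; apply/eqP; rewrite -subr_eq0; apply/eqP.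
rewrite -[RHS](FJ _ (J1_right b v)) rmorphB rmorphM !Fgen rhoZ /= rho_D.
by congr (_ - _); apply: endk_ext.
Qed.

(** As [rho](bD) is multiplication by b, the commutator relation evaluated at e is the Leibniz rule
    for [rho v] at be. *)
Lemma conn_relations (E : lmodType A) (rho : L -> endk iota E)
    (F : {rmorphism T -> endk iota E}) :
  (forall u, F [u] = rho u) -> linear rho ->
  is_conn rho <-> forall s, J2_gen s -> F s = 0.
Proof.
move=> Fgen rho_lin; have /= rhoZ := linearZ_LR (linear_of rho_lin).
split=> [[_ rho_D rho_leibniz] s [|a u|b v]|FJ].
- by rewrite rmorphB rmorph1 Fgen rho_D subrr.
- rewrite rmorphB rmorphM !Fgen !rhoZ /= rho_D; apply/eqP.
  by rewrite subr_eq0; apply/eqP/endk_ext.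
- rewrite !rmorphB !rmorphM !Fgen !rhoZ /= rho_D; apply: endk_ext => e /=.
  by rewrite rho_leibniz -addrA -opprD subrr.
have rho_D : rho (dl_D L) = endk_id iota E.
  by apply/eqP; rewrite -subr_eq0 -Fgen -(FJ _ (J2_D L)) rmorphB rmorph1.
split=> // v b e; have := FJ _ (J2_conn b v).
rewrite !rmorphB !rmorphM !Fgen !rhoZ /= rho_D => /(congr1 (fun p : endk iota E => p e)) /=.
by move/eqP; rewrite subr_eq0 subr_eq addrC => /eqP.
Qed.

End Presentations.
End EnvelopeFunctors.
End Equivalences.

Theorem theorem1p1 (k A : comPzRingType) (iota : {rmorphism k -> A}) (f : cocycle2 iota) :
  (exists U : functor_on (C := DLieCat f) (D := RingCat) (fun L => Uotimes L),
     forall (L M : dlie f) (phi : dlie_hom L M) (s : seq L),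
       (fmap U phi : {rmorphism Uotimes L -> Uotimes M}) (Uotimes_cls s) =
       Uotimes_cls (map phi s)) /\
  (exists U : functor_on (C := DLieCat f) (D := RingCat) (fun L => Urho L),
     forall (L M : dlie f) (phi : dlie_hom L M) (s : seq L),
       (fmap U phi : {rmorphism Urho L -> Urho M}) (Urho_cls s) =
       Urho_cls (map phi s)) /\
  (forall L : dlie f,
     (exists F1 : functor (ModId L) (LMod (Uotimes L)),
        [/\ is_equivalence F1,
            exact_functor (ModId_forget L) (LMod_forget (Uotimes L)) F1,
            preserves_injectives F1 & preserves_projectives F1]) /\
     (exists F2 : functor (Conn L) (LMod (Urho L)),
        [/\ is_equivalence F2,
            exact_functor (Conn_forget L) (LMod_forget (Urho L)) F2,
            preserves_injectives F2 & preserves_projectives F2])).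
Proof.
split; first exact: envelope_functor (@J1_gen_map _ _ _ f).
split; first exact: envelope_functor (@J2_gen_map _ _ _ f).
move=> L; split.
  have P_lin E (rho : L -> endk iota E) : is_modId rho -> linear rho.
    by case=> -[].
  have equiv := rep_functor_equivalence P_lin (@modId_relations _ _ _ _ L)
    (J1_D L) (@J1_left _ _ _ _ L).
  exists (rep_functor P_lin (@modId_relations _ _ _ _ L) (J1_D L)).
  split; first exact: equiv.
  - exact: rep_functor_exact.
  - exact: equivalence_injectives.
  - exact: equivalence_projectives.
have P_lin E (rho : L -> endk iota E) : is_conn rho -> linear rho by case.
have equiv := rep_functor_equivalence P_lin (@conn_relations _ _ _ _ L)
  (J2_D L) (@J2_left _ _ _ _ L).
exists (rep_functor P_lin (@conn_relations _ _ _ _ L) (J2_D L)).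
split; first exact: equiv.
- exact: rep_functor_exact.
- exact: equivalence_injectives.
- exact: equivalence_projectives.
Qed.
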